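(* Let $n\geq 2$ be an integer and let $G$ be an arbitrary finite, simple, connected graph with at least two vertices. Then: (i) For the complete graph $K_n$ on $n$ vertices, $$\mathrm{QEC}(G\{K_n\})=\frac{(n\,\mathrm{QEC}(G)-n)+\sqrt{(n\,\mathrm{QEC}(G)-n)^2+4n\,\mathrm{QEC}(G)}}{2}.$$ (ii) For the star graph $K_{1,n-1}$ on $n$ vertices, rooted at its center, $$\mathrm{QEC}(G\{K_{1,n-1}\})=\frac{(n\,\mathrm{QEC}(G)-2)+\sqrt{(n\,\mathrm{QEC}(G)-2)^2+8\,\mathrm{QEC}(G)}}{2}.$$
   Context: All graphs are finite, simple, connected and unweighted. For a graph $G=(V,E)$, the distance matrix $D_G$ is the real symmetric $V\times V$ matrix whose $(v,w)$ entry is the length of a shortest path joining $v$ and $w$ (and $0$ if $v=w$). Let $C(V)$ be the space of real-valued functions on $V$, with canonical inner product $\langle\cdot,\cdot\rangle$, and let $e\in C(V)$ be the constant function $1$. For a graph $G$ with at least two vertices, the quadratic embedding constant is $$\mathrm{QEC}(G)=\max\{\langle f,D_Gf\rangle : f\in C(V),\ \langle f,f\rangle=1,\ \langle e,f\rangle=0\}.$$ Given a graph $G_1$ with vertex set $V(G_1)$ and a rooted graph $G_2$, the cluster $G_1\{G_2\}$ is the graph obtained by taking one copy of $G_1$ and $|V(G_1)|$ disjoint copies of $G_2$, and identifying the root of the $i$-th copy of $G_2$ with the $i$-th vertex of $G_1$, for $i=1,\dots,|V(G_1)|$ (the same root vertex being used in every copy). For $K_n$ the choice of root is immaterial. For $K_{1,1}$,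 either vertex may be designated as the center. *)

(* Defs.v *)
From mathcomp Require Import all_boot all_order all_algebra.
From mathcomp Require Import all_classical all_reals all_analysis.

Set Implicit Arguments.
Unset Strict Implicit.
Unset Printing Implicit Defensive.

Import Order.TTheory GRing.Theory Num.Theory.
Import numFieldNormedType.Exports.

Local Open Scope classical_set_scope.
Local Open Scope ring_scope.

Record sgraph := SGraph {
  vertex :> finType;
  edge : rel vertex;
  edge_sym : symmetric edge;
  edge_irrefl : irreflexive edge
}.

Definition connected_graph (G : sgraph) : Prop :=
  forall x y : G, connect (@edge G) x y.

Definition walk (G : sgraph) (x y : G) (k : nat) : bool :=
  [exists p : k.-tuple G, path (@edge G) x p && (last x p == y)].

(* The least length of a walk from x to y. A shortest path has fewer than #|G|
   edges, so it is enough to search below #|G|; the junk value #|G| is only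
   reached when x and y lie in different components (see gdistP). *)
Definition gdist (G : sgraph) (x y : G) : nat :=
  find (walk x y) (iota 0 #|G|).

Lemma gdistP (G : sgraph) (x y : G) : connect (@edge G) x y ->
  walk x y (gdist x y) /\ (forall k, walk x y k -> (gdist x y <= k)%N).
Proof.
move=> /connectP[p ep ->]; have [q eq_ uq _] := shortenP ep.
have szq : (size q < #|G|)%N by have := max_card (mem (x :: q)); rewrite (card_uniqP uq).
set y' := last x q.
have wq : walk x y' (size q).
  by apply/existsP; exists (in_tuple q); rewrite /= eq_ eqxx.
have hw : has (walk x y') (iota 0 #|G|).
  by apply/hasP; exists (size q) => //; rewrite mem_iota.
split=> [|k wk].
  have := nth_find 0 hw; rewrite nth_iota ?add0n //.
  by rewrite has_find size_iota in hw.
rewrite leqNgt; apply/negP => lt_k.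
have := before_find 0 lt_k; rewrite nth_iota ?add0n ?wk //.
by apply: leq_trans lt_k _; rewrite -[leqRHS](size_iota 0) find_size.
Qed.

Definition inner (R : realType) (T : finType) (f g : T -> R) : R :=
  \sum_x f x * g x.

Definition dist_op (R : realType) (G : sgraph) (f : G -> R) : G -> R :=
  fun x => \sum_y (gdist x y)%:R * f y.

Definition unit_mean0 (R : realType) (T : finType) : set (T -> R) :=
  [set f | inner f f = 1 /\ inner (fun=> 1) f = 0].

(* The supremum is a maximum as soon as G has two vertices: see QEC_max. *)
Definition QEC (R : realType) (G : sgraph) : R :=
  sup [set inner f (dist_op f) | f in @unit_mean0 R G].

Lemma QEC_max (R : realType) (G : sgraph) : (2 <= #|G|)%N ->
  (exists2 f, @unit_mean0 R G f & inner f (dist_op f) = QEC R G) /\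
  (forall f, @unit_mean0 R G f -> inner f (dist_op f) <= QEC R G).
Proof.
move=> G2; pose T : topologicalType := prod_topology (fun _ : G => R).
have cproj (x : G) : continuous (fun f : T => f x).
  exact: (@proj_continuous G (fun=> R) x).
have csum (F : G -> T -> R) : (forall x, continuous (F x)) ->
    continuous (fun f => \sum_x F x f).
  move=> cF; apply: (@continuous_big R G +%R 0 xpredT) => // u.
  by apply: (@cvgD R R^o); [exact: cvg_fst|exact: cvg_snd].
have cmul (F H : T -> R) : continuous F -> continuous H ->
    continuous (fun f => F f * H f).
  by move=> cF cH f; apply: (@cvgM R T (nbhs f) _ F H); [exact: cF|exact: cH].
have ccst (c : R) : continuous (fun _ : T => c).
  exact: (@cst_continuous T R c).
have cq : continuous (fun f : T => inner f (dist_op f)).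
  by apply/csum => x; apply/cmul => //; apply/csum => y; exact: cmul.
have cn : continuous (fun f : T => inner f f) by apply/csum => x; exact: cmul.
have ce : continuous (fun f : T => inner (fun=> 1) f).
  by apply/csum => x; exact: cmul.
have K0 : @unit_mean0 R G !=set0.
  have /card_gt1P[a [b [_ _ ab]]] : (1 < #|(xpredT : pred G)|)%N by [].
  pose s : R := Num.sqrt 2^-1.
  exists (fun x => if x == a then s else if x == b then - s else 0).
  split; rewrite /inner (bigD1 a)//= (bigD1 b) 1?eq_sym//= !eqxx.
    rewrite [b == a]eq_sym (negbTE ab) big1 => [|x /andP[/negbTE-> /negbTE->]];
      last by rewrite mul0r.
    by rewrite mulrNN addr0 -expr2 sqr_sqrtr ?invr_ge0// -[2^-1]div1r -splitr.
  rewrite [b == a]eq_sym (negbTE ab) big1 => [|x /andP[/negbTE-> /negbTE->]];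
    last by rewrite mulr0.
  by rewrite !mul1r addr0 subrr.
have cK : @compact T (@unit_mean0 R G).
  have cB : @compact T [set f | forall x : G, `[-1, 1]%classic (f x)].
    exact: (@tychonoff G (fun=> R) _ (fun=> @segment_compact R (-1) 1)).
  have clK : @closed T (@unit_mean0 R G).
    rewrite (_ : @unit_mean0 R G = (fun f : T => inner f f) @^-1` [set x | x = 1] `&`
        (fun f : T => inner (fun=> 1) f) @^-1` [set x | x = 0]) //.
    apply: closedI; apply: preimage_closed; try exact: closed_eq.
      by move=> f _; exact: cn.
    by move=> f _; exact: ce.
  apply: (subclosed_compact clK cB).
  move=> f [f1 _] x /=; rewrite in_itv/= -ler_norml.
  rewrite -(@expr_le1 _ 2)// real_normK ?num_real// -f1 /inner (bigD1 x)//= expr2 lerDl.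
  by apply: sumr_ge0 => y _; rewrite -expr2 sqr_ge0.
have [|f Kf fmax] := @compact_EVT_max T R (fun f => inner f (dist_op f)) _ K0 cK.
  exact: continuous_subspaceT.
move: Kf; rewrite inE => Kf.
pose A := [set inner f (dist_op f) | f in @unit_mean0 R G].
have ubA : ubound A (inner f (dist_op f)).
  by move=> _ [g Kg <-]; apply: fmax; rewrite inE.
have supA g : @unit_mean0 R G g -> inner g (dist_op g) <= QEC R G.
  move=> Kg; apply: (@ub_le_sup R A); last by exists g.
  by exists (inner f (dist_op f)).
split=> //; exists f => //; apply/eqP; rewrite eq_le supA//=.
by apply: ge_sup => //; exists (inner f (dist_op f)); exists f.
Qed.

Section complete_graph.
Variable n : nat.

Definition complete_edge : rel 'I_n := fun x y => x != y.

Lemma complete_edge_sym : symmetric complete_edge.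
Proof. by move=> x y; rewrite /complete_edge eq_sym. Qed.

Lemma complete_edge_irrefl : irreflexive complete_edge.
Proof. by move=> x; rewrite /complete_edge eqxx. Qed.

Definition complete_graph : sgraph :=
  SGraph complete_edge_sym complete_edge_irrefl.

End complete_graph.

Section complete_bipartite.
Variables m n : nat.

Definition bipartite_edge : rel ('I_m + 'I_n)%type := fun x y =>
  match x, y with
  | inl _, inr _ | inr _, inl _ => true
  | _, _ => false
  end.

Lemma bipartite_edge_sym : symmetric bipartite_edge.
Proof. by move=> [x|x] [y|y]. Qed.

Lemma bipartite_edge_irrefl : irreflexive bipartite_edge.
Proof. by case. Qed.

Definition complete_bipartite : sgraph :=
  SGraph bipartite_edge_sym bipartite_edge_irrefl.

End complete_bipartite.

(* In K_{1,n-1} with n > 2 only the vertex of the part of size one qualifies;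
   in K_{1,1} both vertices do. *)
Definition is_center (G : sgraph) (c : G) : Prop :=
  forall x : G, x != c -> edge c x.

(* (i, x) is the vertex x of the copy of H attached at i; the vertex i of G is
   identified with the root (i, o) of that copy. *)
Section cluster_graph.
Variables (G H : sgraph) (o : H).

Definition cluster_edge : rel (G * H)%type := fun u v =>
  ((u.1 == v.1) && edge u.2 v.2) ||
  [&& u.2 == o, v.2 == o & edge u.1 v.1].

Lemma cluster_edge_sym : symmetric cluster_edge.
Proof.
move=> u v; rewrite /cluster_edge eq_sym (@edge_sym H) (@edge_sym G).
by rewrite [(u.2 == o) && _]andbCA.
Qed.

Lemma cluster_edge_irrefl : irreflexive cluster_edge.
Proof. by move=> u; rewrite /cluster_edge !edge_irrefl !andbF. Qed.

Definition cluster_graph : sgraph :=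
  SGraph cluster_edge_sym cluster_edge_irrefl.

End cluster_graph.

(* Main.v *)
Require Import Defs.
From mathcomp Require Import all_boot all_order all_algebra.
From mathcomp Require Import all_classical all_reals all_analysis.
From mathcomp Require Import ring lra.
Set Implicit Arguments.
Unset Strict Implicit.
Unset Printing Implicit Defensive.
Import Order.TTheory GRing.Theory Num.Theory.
Local Open Scope ring_scope.

(** Both parts are instances of [QEC_cluster], on clusters [G{H}] whose root [o]
    is adjacent to all other vertices of [H], these being at mutual distance
    [s]: [s = 1] for complete graphs and [s = 2] for stars.

    In a cluster, a path between different copies passes through their roots
    ([gdist_cluster]). On a function [f] with zero mean, the contributions of
    the legs from a vertex to its root cancel, and, writing [u i] for the sum
    of [f] over copy [i], [b i] for the sum over its non-root vertices, and
    [S i] for the sum of squares there, the distance form becomes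
    [<u, D_G u> - \sum_i ((2 - s) * b i ^+ 2 + s * S i)]
    ([dist_form_cluster]). As [u] has zero mean, [<u, D_G u>] is at most
    [q * <u, u>] with [q] = QEC(G), and equality is possible. The problem thus
    decouples into identical problems, one for each copy: find the least [lam]
    such that
    [q * (a + b) ^+ 2 - (2 - s) * b ^+ 2 - s * S <= lam * (a ^+ 2 + S)].
    With [m] non-root vertices, Cauchy-Schwarz gives [b ^+ 2 <= m * S]; as
    [lam + s >= 0], the worst case is a function constant off the root, and [lam] is the value at
    which a binary quadratic form degenerates. This is the larger root of
    [X ^+ 2 - ((m + 1) * q - E) * X - E * q], with [E = s + m * (2 - s)], that is,
    [E = n] for [K_n] and [E = 2] for the star on [n] vertices
    ([cluster_eigenvalue]). The needed inequalities on [lam] follow from signs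
    of the polynomial at well-chosen points: it is [- m * q ^+ 2] both at [q] and
    at [m * q - E] ([cluster_eigenvalue_vertex_bound]). An extremal function of
    [G] multiplied by a kernel vector of the form reaches the bound
    ([cluster_eigenvalue_attained]). *)

(** * Walks and graph distance *)

Lemma walk0 (G : sgraph) (x y : G) : walk x y 0 = (x == y).
Proof.
apply/existsP/eqP => [[p]|->]; first by rewrite tuple0 /= => /eqP.
by exists [tuple]; rewrite /= eqxx.
Qed.

Lemma walkS (G : sgraph) (x y : G) k :
  walk x y k.+1 = [exists z, edge x z && walk z y k].
Proof.
apply/existsP/existsP => [[p]|[z /andP[xz /existsP[p /andP[zp py]]]]].
  case/tupleP: p => z p /= /andP[/andP[xz zp] py].
  by exists z; rewrite xz; apply/existsP; exists p; rewrite zp.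
by exists (cons_tuple z p); rewrite /= xz zp.
Qed.

Lemma walk_connect (G : sgraph) (x y : G) k :
  walk x y k -> connect (@edge G) x y.
Proof.
by case/existsP => p /andP[xp /eqP <-]; apply/connectP; exists p.
Qed.

(** Distances are computed by guessing a potential: the Lipschitz condition
    bounds every walk from below, and following the descent condition produces
    a walk whose length is the potential. *)
Lemma gdist_unique (G : sgraph) (y : G) (phi : G -> nat) :
    phi y = 0%N ->
    (forall x z, edge x z -> (phi x <= (phi z).+1)%N) ->
    (forall x, x != y -> exists2 z, edge x z & phi x = (phi z).+1) ->
  forall x, gdist x y = phi x.
Proof.
move=> phi0 lip desc x.
have low k : forall u, walk u y k -> (phi u <= k)%N.
  elim: k => [|k IH] u; first by rewrite walk0 => /eqP ->; rewrite phi0.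
  rewrite walkS => /existsP[z /andP[uz /IH le_z]].
  by apply: leq_trans (lip _ _ uz) _.
have upp k : forall u, phi u = k -> walk u y k.
  elim: k => [|k IH] u uk.
    by rewrite walk0; apply/eqP; apply: contra_eq uk => /desc[z _ ->].
  have [uy|/desc[z uz]] := eqVneq u y; first by move: uk; rewrite uy phi0.
  rewrite uk => -[kz]; rewrite walkS; apply/existsP.
  by exists z; rewrite uz IH.
have wx := upp _ x erefl; have [w le_w] := gdistP (walk_connect wx).
by apply/eqP; rewrite eqn_leq le_w // low.
Qed.

Section Distance.
Variables (G : sgraph) (Gconn : connected_graph G).
Implicit Types x y z : G.

Lemma gdist_xx x : gdist x x = 0%N.
Proof.
have [_ le_w] := gdistP (Gconn x x).
by apply/eqP; rewrite -leqn0 le_w // walk0.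
Qed.

Lemma gdist_lip x y z : edge x z -> (gdist x y <= (gdist z y).+1)%N.
Proof.
move=> xz; have [w _] := gdistP (Gconn z y).
have [_] := gdistP (Gconn x y); apply.
by rewrite walkS; apply/existsP; exists z; rewrite xz.
Qed.

Lemma gdist_descent x y : x != y ->
  exists2 z, edge x z & gdist x y = (gdist z y).+1.
Proof.
move=> xy; have [w _] := gdistP (Gconn x y).
case dxy: (gdist x y) w => [|k]; first by rewrite walk0 (negbTE xy).
rewrite walkS => /existsP[z /andP[xz w]]; exists z => //.
apply/eqP; rewrite eqn_leq -{1}dxy gdist_lip // ltnS.
by have [_] := gdistP (Gconn z y); apply.
Qed.

Lemma gdist_edge x y : edge x y -> gdist x y = 1%N.
Proof.
move=> xy; apply/eqP; rewrite eqn_leq -{1}(gdist_xx y) gdist_lip //=.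
have [z _ ->//] : exists2 z, edge x z & gdist x y = (gdist z y).+1.
by apply: gdist_descent; apply: contraTneq xy => ->; rewrite edge_irrefl.
Qed.

Lemma gdist_eq0 x y : (gdist x y == 0%N) = (x == y).
Proof.
apply/eqP/eqP => [/eqP|->]; last exact: gdist_xx.
by apply: contraTeq => /gdist_descent[z _ ->].
Qed.

Lemma gdist_common_neighbour x y z :
  x != y -> ~~ edge x y -> edge x z -> edge z y -> gdist x y = 2%N.
Proof.
move=> xy nxy xz zy; apply/eqP.
rewrite eqn_leq -{1}(gdist_edge zy) gdist_lip //=.
have [t xt ->] := gdist_descent xy.
by rewrite ltnS lt0n gdist_eq0; apply: contra nxy => /eqP <-.
Qed.
End Distance.

(** * Distances in a cluster *)

(** A shortest path between two different copies has to leave the first one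
    and enter the second one through their roots. *)
Lemma gdist_cluster {G H : sgraph} (o : H) :
    connected_graph G -> connected_graph H ->
  forall u v : cluster_graph G o, gdist u v =
    if u.1 == v.1 then gdist u.2 v.2
    else (gdist u.1 v.1 + gdist u.2 o + gdist o v.2)%N.
Proof.
move=> Gc Hc u [j y] /=; pose phi (u : cluster_graph G o) :=
  if u.1 == j then gdist u.2 y
  else (gdist u.1 j + gdist u.2 o + gdist o y)%N.
have phio i : phi (i, o) = (gdist i j + gdist o y)%N.
  by rewrite /phi /=; case: eqP => [->|_]; rewrite gdist_xx // addn0.
apply: (@gdist_unique (cluster_graph G o) (j, y) phi).
- by rewrite /phi /= eqxx gdist_xx.
- move=> [i x] [i' x'] /orP[/andP[/= /eqP<- xx']|/and3P[/= /eqP-> /eqP-> ii']].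
    rewrite /phi /=; case: eqP => _; first exact: gdist_lip.
    by rewrite -addSn -addnS leq_add2r leq_add2l gdist_lip.
  by rewrite !phio -addSn leq_add2r gdist_lip.
- move=> [i x] neq; have [ij|nij] := eqVneq i j.
    have xy : x != y by apply: contraNneq neq => ->; rewrite ij.
    have [z xz dz] := gdist_descent Hc xy.
    by exists (i, z); rewrite /phi /= ?ij ?eqxx // /edge /= /cluster_edge /= eqxx xz.
  have [->|xo] := eqVneq x o.
    have [k ik dk] := gdist_descent Gc nij.
    by exists (k, o); rewrite ?phio ?dk // /edge /= /cluster_edge /= !eqxx ik orbT.
  have [z xz dz] := gdist_descent Hc xo.
  exists (i, z); first by rewrite /edge /= /cluster_edge /= eqxx xz.
  by rewrite /phi /= (negbTE nij) dz addnS addSn.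
Qed.

(** * The distance form on functions with zero mean *)

Section QuadraticForm.
Context {R : realType} {G : sgraph}.
Implicit Types f g : G -> R.

Lemma inner_ge0 f : 0 <= inner f f.
Proof. by apply: sumr_ge0 => x _; rewrite -expr2 sqr_ge0. Qed.

Lemma inner_scale c f : inner (fun x => c * f x) (fun x => c * f x) =
  c ^+ 2 * inner f f.
Proof. by rewrite /inner mulr_sumr; apply: eq_bigr => x _; ring. Qed.

Lemma dist_form_scale c f :
  inner (fun x => c * f x) (dist_op (fun x => c * f x)) = c ^+ 2 * inner f (dist_op f).
Proof.
rewrite /inner mulr_sumr; apply: eq_bigr => x _; rewrite /dist_op.
under eq_bigr do rewrite mulrCA.
by rewrite -mulr_sumr; ring.
Qed.

Lemma unit_mean0_normalize f : 0 < inner f f -> \sum_x f x = 0 ->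
  @unit_mean0 R G (fun x => (Num.sqrt (inner f f))^-1 * f x).
Proof.
move=> f0 mf; split.
  by rewrite inner_scale exprVn sqr_sqrtr ?(ltW f0) // mulVf // gt_eqF.
by rewrite /inner; under eq_bigr do rewrite mul1r; rewrite -mulr_sumr mf mulr0.
Qed.

Lemma dist_form_le f : (2 <= #|G|)%N -> \sum_x f x = 0 ->
  inner f (dist_op f) <= QEC R G * inner f f.
Proof.
move=> G2 mf; have [_ le_QEC] := QEC_max R G2.
have [f0|f0] := leP (inner f f) 0.
  have fz x : f x = 0.
    have /eqP : inner f f = 0 by apply/le_anti; rewrite f0 inner_ge0.
    rewrite psumr_eq0 => [/allP/(_ x)|y _]; last by rewrite -expr2 sqr_ge0.
    by rewrite mem_index_enum => /(_ isT); rewrite mulf_eq0 orbb => /eqP.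
  by rewrite /inner !big1 ?mulr0 // => x _; rewrite fz mul0r.
have := le_QEC _ (unit_mean0_normalize f0 mf).
rewrite dist_form_scale exprVn sqr_sqrtr ?(ltW f0) // ler_pdivrMl //.
by rewrite [inner f f * _]mulrC.
Qed.

(** QEC is pinned down by a bound on all zero-mean functions together with one
    nonzero function, of any norm, that reaches it: both sides are
    homogeneous of degree two. *)
Lemma QEC_eq c f : (2 <= #|G|)%N ->
    (forall g, \sum_x g x = 0 -> inner g (dist_op g) <= c * inner g g) ->
    \sum_x f x = 0 -> 0 < inner f f -> inner f (dist_op f) = c * inner f f ->
  QEC R G = c.
Proof.
move=> G2 ub mf f0 fc; have [[g [g1 mg] gQ] _] := QEC_max R G2.
apply/le_anti/andP; split.
  rewrite -gQ -[c]mulr1 -g1; apply: ub.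
  by move: mg; rewrite /inner; under eq_bigr do rewrite mul1r.
by rewrite -(ler_pM2r f0) -fc dist_form_le.
Qed.
End QuadraticForm.

(** * Quadratic equations and quadratic forms *)

Section LargerRoot.
Context {R : rcfType}.
Implicit Types b c x : R.

Definition larger_root b c : R := (b + Num.sqrt (b ^+ 2 + 4 * c)) / 2.

Lemma larger_rootP b c : 0 <= b ^+ 2 + 4 * c ->
  larger_root b c ^+ 2 = b * larger_root b c + c.
Proof.
move=> /sqr_sqrtr; rewrite /larger_root.
set s := Num.sqrt _ => sE; have -> : c = (s ^+ 2 - b ^+ 2) / 4 by rewrite sE; field.
by field.
Qed.

Lemma le_larger_root b c x : x ^+ 2 - b * x - c <= 0 -> x <= larger_root b c.
Proof.
move=> px; rewrite /larger_root ler_pdivlMr // addrC -lerBlDr.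
apply: le_trans (ler_norm _) _; rewrite -sqrtr_sqr ler_wsqrtr //.
by rewrite -subr_ge0; nra.
Qed.

(** A monic quadratic that takes a nonpositive value has real roots. *)
Lemma le_larger_root_discr b c x :
  x ^+ 2 - b * x - c <= 0 -> 0 <= b ^+ 2 + 4 * c.
Proof. by move=> px; have := sqr_ge0 (2 * x - b); nra. Qed.

End LargerRoot.

Lemma degenerate_form_ge0 (R : realDomainType) (A B C a b : R) :
    0 <= A -> 0 <= C -> A * C = B ^+ 2 ->
  0 <= A * a ^+ 2 - 2 * B * a * b + C * b ^+ 2.
Proof.
rewrite le_eqVlt => /orP[/eqP <- C0|A0 _ AC].
  rewrite mul0r => /esym/eqP; rewrite sqrf_eq0 => /eqP ->.
  by rewrite mulr0 !mul0r subrr add0r mulr_ge0 // sqr_ge0.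
rewrite -(pmulr_rge0 _ A0).
have -> : A * (A * a ^+ 2 - 2 * B * a * b + C * b ^+ 2) =
   (A * a) ^+ 2 - 2 * (A * a) * (B * b) + (A * C) * b ^+ 2 by ring.
rewrite AC (_ : _ + _ = (A * a - B * b) ^+ 2) ?sqr_ge0 //; ring.
Qed.

(** Cauchy-Schwarz against the indicator function of [P]: up to a factor, the
    defect is the sum of the squared deviations from the mean. *)
Lemma sqr_sum_le (R : realDomainType) (I : finType) (P : pred I) (g : I -> R) :
  (\sum_(i | P i) g i) ^+ 2 <= #|P|%:R * \sum_(i | P i) g i ^+ 2.
Proof.
set b := \sum_(i | P i) g i; set S := \sum_(i | P i) g i ^+ 2.
have [m0|m0] := posnP #|P|.
  rewrite m0 mul0r /b big_pred0 ?expr0n // => i.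
  exact: (card0_eq m0 i).
have {}m0 : 0 < #|P|%:R :> R by rewrite ltr0n.
rewrite -subr_ge0 -(pmulr_rge0 _ m0); set m : R := #|P|%:R.
have -> : m * (m * S - b ^+ 2) = \sum_(i | P i) (m * g i - b) ^+ 2.
  have expand i : (m * g i - b) ^+ 2 = m ^+ 2 * g i ^+ 2 - 2 * m * b * g i + b ^+ 2.
    by ring.
  under eq_bigr do rewrite expand.
  rewrite big_split sumrB /= -!mulr_sumr -/S -/b sumr_const -[_ *+ #|P|]mulr_natr.
  by rewrite -/m; ring.
by apply: sumr_ge0 => i _; exact: sqr_ge0.
Qed.

(** * The distance form of a cluster *)

Section Cluster.
(** Both the complete graph, with [s = 1], and the star, with [s = 2], have a
    root adjacent to all other vertices, which are at mutual distance [s]. *)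
Variables (R : realType) (G H : sgraph) (o : H) (s : nat).
Hypotheses (Gconn : connected_graph G) (oH : is_center o).
Hypothesis distH : forall x y : H, x != o -> y != o -> x != y -> gdist x y = s.

Lemma connected_center : connected_graph H.
Proof.
have ox x : connect (@edge H) o x.
  by have [->|/oH/connect1//] := eqVneq x o.
have sym : connect_sym (@edge H) by apply: sym_connect_sym; exact: edge_sym.
by move=> x y; apply: connect_trans (ox y); rewrite sym.
Qed.

Lemma gdist_center (x : H) : gdist o x = (x != o) /\ gdist x o = (x != o).
Proof.
have Hc := connected_center.
have [->|xo] := eqVneq x o; first by rewrite gdist_xx.
by have ox := oH xo; rewrite !gdist_edge // edge_sym.
Qed.

(** Up to terms depending on one endpoint only, the distance in the cluster is
    that of [G] corrected inside each copy by minus twice the Gromov product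
    at the root, which for two non-root vertices is 1 if they coincide and
    [(2 - s) / 2] otherwise. *)
Lemma gdist_cluster_center (u v : cluster_graph G o) :
  (gdist u v)%:R = (gdist u.1 v.1)%:R + (u.2 != o)%:R + (v.2 != o)%:R
    - (u.1 == v.1)%:R * (u.2 != o)%:R *
      ((v.2 != o)%:R * (2 - s%:R) + (u.2 == v.2)%:R * s%:R) :> R.
Proof.
have Hc := connected_center.
case: u v => i x [j y]; rewrite gdist_cluster //=.
have [<-|ij] := eqVneq i j; last first.
  by rewrite !natrD (gdist_center x).2 (gdist_center y).1 /=; ring.
rewrite gdist_xx //.
have [->|xo] := eqVneq x o; first by rewrite (gdist_center y).1 /=; ring.
have [->|yo] := eqVneq y o.
  by rewrite (gdist_center x).2 (negbTE xo) /=; ring.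
have [->|xy] := eqVneq x y; first by rewrite gdist_xx //=; ring.
by rewrite distH //=; ring.
Qed.

Variable f : cluster_graph G o -> R.

Definition fibre_sum (i : G) : R := \sum_x f (i, x).
Definition nonroot_sum (i : G) : R := \sum_(x | x != o) f (i, x).
Definition nonroot_sqr (i : G) : R := \sum_(x | x != o) f (i, x) ^+ 2.

Lemma fibre_sumE i : fibre_sum i = f (i, o) + nonroot_sum i.
Proof. by rewrite /fibre_sum (bigD1 o). Qed.

Lemma sum_cluster (F : cluster_graph G o -> R) :
  \sum_u F u = \sum_(i : G) \sum_(x : H) F (i, x).
Proof. by rewrite pair_bigA /=; apply: eq_bigr => -[]. Qed.

Lemma inner_cluster : inner f f = \sum_i (f (i, o) ^+ 2 + nonroot_sqr i).
Proof.
rewrite /inner sum_cluster; apply: eq_bigr => i _.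
by under eq_bigr do rewrite -expr2; rewrite (bigD1 o).
Qed.

Lemma sum_nonroot (g : H -> R) : \sum_x (x != o)%:R * g x = \sum_(x | x != o) g x.
Proof.
by rewrite [RHS]big_mkcond; apply: eq_bigr => x _; case: eqP; rewrite ?mul0r ?mul1r.
Qed.

Hypothesis mf : \sum_u f u = 0.

Lemma sum_fibre_sum : \sum_i fibre_sum i = 0.
Proof. by move: mf; rewrite sum_cluster. Qed.

Lemma dist_op_cluster i x : dist_op f (i, x) =
  dist_op fibre_sum i + \sum_j nonroot_sum j
    - (x != o)%:R * ((2 - s%:R) * nonroot_sum i + s%:R * f (i, x)).
Proof.
have delta (T : finType) (t : T) (g : T -> R) : \sum_t' (t == t')%:R * g t' = g t.
  rewrite (bigD1 t) //= eqxx mul1r big1 ?addr0 // => t' /negbTE.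
  by rewrite eq_sym => ->; rewrite mul0r.
rewrite {1}/dist_op sum_cluster.
have inner_sum j : \sum_y (@gdist (cluster_graph G o) (i, x) (j, y))%:R * f (j, y) =
    (gdist i j)%:R * fibre_sum j + (x != o)%:R * fibre_sum j + nonroot_sum j
    - (i == j)%:R * ((x != o)%:R * ((2 - s%:R) * nonroot_sum j + s%:R * f (j, x))).
  under eq_bigr do rewrite gdist_cluster_center /=.
  rewrite -[f (j, x)](delta _ x (fun y => f (j, y))) /nonroot_sum -sum_nonroot /fibre_sum.
  rewrite !(mulr_sumr, =^~ big_split, =^~ sumrB) /=.
  by apply: eq_bigr => y _; ring.
rewrite (eq_bigr _ (fun j _ => inner_sum j)) sumrB !big_split /= delta.
by rewrite -[\sum_i0 (x != o)%:R * _]mulr_sumr sum_fibre_sum mulr0 addr0.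
Qed.

(** The one-endpoint terms of the distance die on zero-mean functions, which
    leaves the form of [G] and a sum of terms living in a single copy. *)
Lemma dist_form_cluster : inner f (dist_op f) =
  inner fibre_sum (dist_op fibre_sum)
    - \sum_i ((2 - s%:R) * nonroot_sum i ^+ 2 + s%:R * nonroot_sqr i).
Proof.
set B := \sum_j nonroot_sum j.
have inner_sum i : \sum_x f (i, x) * dist_op f (i, x) =
    fibre_sum i * dist_op fibre_sum i + fibre_sum i * B
    - ((2 - s%:R) * nonroot_sum i ^+ 2 + s%:R * nonroot_sqr i).
  have expand x : f (i, x) * dist_op f (i, x) =
      (dist_op fibre_sum i + B) * f (i, x)
      - (2 - s%:R) * nonroot_sum i * ((x != o)%:R * f (i, x))
      - s%:R * ((x != o)%:R * f (i, x) ^+ 2).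
    by rewrite dist_op_cluster -/B; ring.
  under eq_bigr do rewrite expand.
  rewrite !sumrB -!mulr_sumr !sum_nonroot.
  by rewrite -/(nonroot_sum i) -/(nonroot_sqr i) -/(fibre_sum i); ring.
rewrite {1}/inner sum_cluster (eq_bigr _ (fun i _ => inner_sum i)).
by rewrite sumrB big_split /= -mulr_suml sum_fibre_sum mul0r addr0.
Qed.

End Cluster.

(** * The eigenvalue of the cluster *)

Section ClusterEigenvalue.
Context {R : rcfType}.
Variables q m c1 c2 : R.
Hypotheses (m0 : 0 < m) (c20 : 0 <= c2) (c21 : c2 <= c1).

Let E := c1 + m * c2.
(** The value [lam] at which the form
    [lam * (a ^+ 2 + b ^+ 2 / m)
      - (q * (a + b) ^+ 2 - c2 * b ^+ 2 - c1 * b ^+ 2 / m)] degenerates: here [a]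
    is the value at the root of a copy, and [b / m] the common value at its
    [m] other vertices. Its determinant vanishes at the two roots of
    [X ^+ 2 - ((m + 1) * q - E) * X - E * q]. *)
Definition cluster_eigenvalue := larger_root ((m + 1) * q - E) (E * q).
Local Notation lam := cluster_eigenvalue.

Let poly_q_le0 : q ^+ 2 - ((m + 1) * q - E) * q - E * q <= 0.
Proof.
have -> : q ^+ 2 - ((m + 1) * q - E) * q - E * q = - (m * q ^+ 2) by ring.
by rewrite oppr_le0 mulr_ge0 ?sqr_ge0 // ltW.
Qed.

Lemma cluster_eigenvalueP : lam ^+ 2 = ((m + 1) * q - E) * lam + E * q.
Proof. exact/larger_rootP/le_larger_root_discr/poly_q_le0. Qed.

Lemma cluster_eigenvalue_ge : q <= lam.
Proof. exact: le_larger_root. Qed.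

(** For [q < 0] the polynomial is nonpositive at [- c1]; for [q >= 0] it may not
    be, but then [lam >= q] suffices. *)
Lemma cluster_eigenvalue_ge_opp : 0 <= lam + c1.
Proof.
rewrite -lerBlDr sub0r.
have [q0|q0] := leP 0 q.
  apply: le_trans cluster_eigenvalue_ge; apply: le_trans q0.
  by rewrite oppr_le0 (le_trans c20).
apply: le_larger_root.
have -> : (- c1) ^+ 2 - ((m + 1) * q - E) * (- c1) - E * q =
  m * (q * (c1 - c2) - c1 * c2) by rewrite /E; ring.
rewrite pmulr_rle0 // subr_le0 (@le_trans _ _ 0) //.
  by rewrite mulr_le0_ge0 ?subr_ge0 // ltW.
by rewrite mulr_ge0 // (le_trans c20).
Qed.

(** After multiplication by [m], the difference of the two sides splits into a
    degenerate positive form in [(a, b)] and [(lam + c1) * (m * S - b ^+ 2)]. *)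
Lemma cluster_eigenvalue_vertex_bound (a b S : R) : b ^+ 2 <= m * S ->
  q * (a + b) ^+ 2 - (c2 * b ^+ 2 + c1 * S) <= lam * (a ^+ 2 + S).
Proof.
move=> bS; rewrite -subr_ge0 -(pmulr_rge0 _ m0).
have lamE := cluster_eigenvalueP.
have form0 : 0 <= m * (lam - q) * a ^+ 2 - 2 * (m * q) * a * b
    + (lam + E - m * q) * b ^+ 2.
  apply: degenerate_form_ge0.
  - by rewrite mulr_ge0 ?subr_ge0 ?cluster_eigenvalue_ge // ltW.
  - rewrite -addrA -opprB subr_ge0; apply: le_larger_root.
    have -> : (m * q - E) ^+ 2 - ((m + 1) * q - E) * (m * q - E) - E * q =
      - (m * q ^+ 2) by ring.
    by rewrite oppr_le0 mulr_ge0 ?sqr_ge0 // ltW.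
  - have -> : m * (lam - q) * (lam + E - m * q) =
      m * (lam ^+ 2 - ((m + 1) * q - E) * lam - E * q + m * q ^+ 2) by ring.
    by rewrite lamE; ring.
have spread0 : 0 <= (lam + c1) * (m * S - b ^+ 2).
  by rewrite mulr_ge0 ?cluster_eigenvalue_ge_opp ?subr_ge0.
apply: le_trans (addr_ge0 form0 spread0) _; rewrite le_eqVlt; apply/orP; left.
by apply/eqP; rewrite /E; ring.
Qed.

(** The kernel of the degenerate form, with [b] now the common value at the
    non-root vertices. *)
Lemma cluster_eigenvalue_attained : exists a b : R, 0 < a ^+ 2 + m * b ^+ 2 /\
  q * (a + m * b) ^+ 2 - (c2 * (m * b) ^+ 2 + c1 * (m * b ^+ 2)) =
  lam * (a ^+ 2 + m * b ^+ 2).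
Proof.
have lamE := cluster_eigenvalueP.
have [q0|q0] := eqVneq q 0.
  (* The generic kernel vector (q, (lam - q) / m) vanishes in this case. *)
  have lam0 : lam = 0.
    have E0 : 0 <= E := addr_ge0 (le_trans c20 c21) (mulr_ge0 (ltW m0) c20).
    have lam_ge0 : 0 <= lam by rewrite -q0 cluster_eigenvalue_ge.
    apply/eqP; rewrite -sqrf_eq0 eq_le sqr_ge0 andbT lamE q0.
    by rewrite !mulr0 sub0r addr0 mulNr oppr_le0 mulr_ge0.
  by exists 1, 0; rewrite lam0 q0; split; [rewrite expr1n expr0n mulr0 addr0|ring].
exists q, ((lam - q) / m); split.
  apply: ltr_pwDl; first by rewrite exprn_even_gt0.
  by rewrite mulr_ge0 ?sqr_ge0 // ltW.
have m0' : m != 0 by rewrite gt_eqF.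
apply/eqP; rewrite -subr_eq0; apply/eqP.
have -> : q * (q + m * ((lam - q) / m)) ^+ 2 -
 (c2 * (m * ((lam - q) / m)) ^+ 2 + c1 * (m * ((lam - q) / m) ^+ 2)) -
 lam * (q ^+ 2 + m * ((lam - q) / m) ^+ 2) =
 (lam - q) / m * - (lam ^+ 2 - ((m + 1) * q - E) * lam - E * q).
  by rewrite /E; field.
by rewrite lamE; ring.
Qed.

End ClusterEigenvalue.

(** The bound holds copy by copy, after replacing the form of [G] on the copy
    sums by QEC(G) times their squared norm. It is reached by spreading an
    extremal function [v] of [G] over the copies: [a * v] on the roots and
    [b * v] elsewhere, with [(a, b)] in the kernel of the degenerate form. *)
Theorem QEC_cluster (R : realType) (G H : sgraph) (o : H) (s : nat) :
    connected_graph G -> (2 <= #|G|)%N -> (2 <= #|H|)%N -> is_center o ->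
    (forall x y : H, x != o -> y != o -> x != y -> gdist x y = s) ->
    (1 <= s <= 2)%N ->
  QEC R (@cluster_graph G H o) =
    cluster_eigenvalue (QEC R G) #|H|.-1%:R s%:R (2 - s%:R).
Proof.
move=> Gc G2 H2 oH distH /andP[s1 s2].
set q := QEC R G; set m : R := #|H|.-1%:R; set c2 : R := 2 - s%:R.
have m0 : 0 < m by rewrite ltr0n -subn1 subn_gt0.
have c20 : 0 <= c2 by rewrite subr_ge0 ler_nat.
have c21 : c2 <= s%:R.
  by rewrite lerBlDr -natrD ler_nat (leq_add s1 s1).
have card_nonroot : #|[pred x | x != o]|%:R = m.
  by rewrite /m -(cardC1 o).
have [a [b [ab0 abE]]] := cluster_eigenvalue_attained q m0 c20 c21.
have [[v [v1 mv] vQ] _] := QEC_max R G2.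
have {}mv : \sum_i v i = 0.
  by move: mv; rewrite /inner; under eq_bigr do rewrite mul1r.
pose f (u : cluster_graph G o) : R := (if u.2 == o then a else b) * v u.1.
have nonrootE i : nonroot_sum f i = m * b * v i.
  rewrite /nonroot_sum (eq_bigr (fun=> b * v i)) => [|x /negbTE xo]; last first.
    by rewrite /f /= xo.
  by rewrite sumr_const -[_ *+ _]mulr_natl card_nonroot mulrA.
have sqrE i : nonroot_sqr f i = m * b ^+ 2 * v i ^+ 2.
  rewrite /nonroot_sqr (eq_bigr (fun=> b ^+ 2 * v i ^+ 2)) => [|x /negbTE xo].
    by rewrite sumr_const -[_ *+ _]mulr_natl card_nonroot mulrA.
  by rewrite /f /= xo exprMn.
have rootE i : f (i, o) = a * v i by rewrite /f /= eqxx.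
have fibreE : fibre_sum f = fun i => (a + m * b) * v i.
  by apply/funext => i; rewrite fibre_sumE rootE nonrootE mulrDl.
have mf : \sum_u f u = 0.
  rewrite sum_cluster -[LHS]/(\sum_i fibre_sum f i) fibreE.
  by rewrite -mulr_sumr mv mulr0.
have vv : \sum_i v i ^+ 2 = 1 by rewrite -v1; apply: eq_bigr => i _; rewrite expr2.
have ff : inner f f = a ^+ 2 + m * b ^+ 2.
  rewrite inner_cluster -[RHS]mulr1 -vv mulr_sumr; apply: eq_bigr => i _.
  by rewrite rootE sqrE; ring.
apply: (@QEC_eq _ _ _ f) => //.
- by rewrite card_prod (leq_trans G2) // leq_pmulr // ltnW.
- move=> g mg; rewrite (dist_form_cluster Gc oH distH) // inner_cluster.
  apply: le_trans (lerB (dist_form_le G2 (sum_fibre_sum mg)) (lexx _)) _.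
  rewrite -/q -/c2 /inner !mulr_sumr -sumrB; apply: ler_sum => i _.
  rewrite -expr2 fibre_sumE; apply: cluster_eigenvalue_vertex_bound => //.
  by rewrite -card_nonroot; exact: sqr_sum_le.
- by rewrite ff.
rewrite (dist_form_cluster Gc oH distH) // fibreE dist_form_scale vQ -/q -/c2 ff -abE.
rewrite mulrC; congr (_ - _); rewrite -[RHS]mulr1 -vv mulr_sumr.
by apply: eq_bigr => i _; rewrite nonrootE sqrE; ring.
Qed.

Theorem theorem1p7 (R : realType) (n : nat) (hn : (2 <= n)%N)
    (G : sgraph) (Gconn : connected_graph G) (G2 : (2 <= #|G|)%N) :
  (forall o : complete_graph n,
     QEC R (@cluster_graph G (complete_graph n) o) =
     ((n%:R * QEC R G - n%:R) +
        Num.sqrt ((n%:R * QEC R G - n%:R) ^+ 2 + 4 * n%:R * QEC R G)) / 2) /\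
  (forall c : complete_bipartite 1 n.-1, is_center c ->
     QEC R (@cluster_graph G (complete_bipartite 1 n.-1) c) =
     ((n%:R * QEC R G - 2) +
        Num.sqrt ((n%:R * QEC R G - 2) ^+ 2 + 8 * QEC R G)) / 2).
Proof.
have nE : n%:R = n.-1%:R + 1 :> R by rewrite natr1 prednK // ltnW.
split=> [ o|c cc].
  have oc : is_center o by move=> x; rewrite eq_sym.
  have Kc := connected_center oc.
  rewrite (@QEC_cluster _ _ _ _ 1) ?card_ord // => [|x y _ _ xy]; last first.
    exact: gdist_edge.
  rewrite /cluster_eigenvalue /larger_root.
  have -> : 1 + n.-1%:R * (2 - 1) = n%:R :> R by rewrite nE; ring.
  by rewrite -nE mulrA.
have cardS : #|complete_bipartite 1 n.-1| = n.
  by rewrite card_sum !card_ord add1n prednK // ltnW.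
have Sc := connected_center cc.
rewrite (@QEC_cluster _ _ _ _ 2) ?cardS // => [|x y xc yc xy]; last first.
  have cx := cc _ xc; have cy := cc _ yc.
  apply: (gdist_common_neighbour Sc (z := c)) => //; last by rewrite edge_sym.
  by move: cx cy; case: (c) (x) (y) => [?|?] [?|?] [?|?].
rewrite /cluster_eigenvalue /larger_root subrr mulr0 addr0 -nE mulrA.
by have -> : 4 * 2 = 8 :> R by ring.
Qed.
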